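(* Let $A,B\subset\mathbb R^n$ be nonempty closed sets and let $x^*\in A\cap B$. Suppose that $B$ intersects $A$ separably at $x^*$ with exponent $\omega\in(0,2)$ and constant $\gamma>0$, and that $B$ is $\omega/2$-H\''older regular at $x^*$ with respect to $A$ with constant $c<\frac{\gamma}{2}$. Then there exists a neighborhood $V$ of $x^*$ such that every sequence $a_k,b_k$ of alternating projections between $A$ and $B$ which enters $V$ converges to a point $b^*\in A\cap B$ with rates $\|b_k-b^*\|=\mathcal O\left(k^{-\frac{2-\omega}{2\omega}}\right)$ and $\|a_k-b^*\|=\mathcal O\left(k^{-\frac{2-\omega}{2\omega}}\right)$ as $k\to\infty$.
   Context: Notation: $\|\cdot\|$ and $\langle\cdot,\cdot\rangle$ are the Euclidean norm and scalar product, $\mathcal B(x,r)$ is the closed Euclidean ball, $d_S(x)=\min\{\|x-s\|:s\in S\}$, and $P_S(x)=\{s\in S:\|x-s\|=d_S(x)\}$ is the (set-valued) projection onto a nonempty closed set $S$. Write $P_A(a)^{-1}=\{b: a\in P_A(b)\}$ for $a\in A$. A sequence of alternating projections between $A$ and $B$ consists of $a_k\in A$, $b_k\in B$ with $b_k\in P_B(a_k)$, $a_{k+1}\in P_A(b_k)$ for $k\in\mathbb N$. It enters $V$ if some $a_k$ or some $b_k$ lies in $V$. A building block $b\to a^+\to b^+$ is a consecutive triple of such a sequence: $b\in P_B(a)$ for some $a\in A$, $a^+\in P_A(b)$, $b^+\in P_B(a^+)$. Separable intersection: $B$ intersects $A$ separably at $x^*\in A\cap B$ with exponent $\omega\in[0,2)$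 and constant $\gamma>0$ if there is a neighborhood $U$ of $x^*$ such that every building block $b\to a^+\to b^+$ in $U$ (i.e. $b,a^+,b^+\in U$) satisfies $$\langle b-a^+,b^+-a^+\rangle\le\left(1-\gamma\|b^+-a^+\|^\omega\right)\|b-a^+\|\,\|b^+-a^+\|.$$ H\''older regularity: for $\sigma\in[0,1)$, $B$ is $\sigma$-H\''older regular with respect to $A$ at $b^*\in A\cap B$ with constant $c>0$ if there is a neighborhood $U$ of $b^*$ such that for every $a^+\in A\cap U$ and every $b^+\in P_B(a^+)\cap U$, with $r=\|a^+-b^+\|$, $$\mathcal B(a^+,(1+c)r)\cap\{b\in P_A(a^+)^{-1}:\langle a^+-b^+,b-b^+\rangle>\sqrt c\,r^{\sigma+1}\|b-b^+\|\}\cap B=\emptyset.$$ *)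

(* Defs.v *)
From HB Require Import structures.
From mathcomp Require Import all_boot all_order all_algebra.
From mathcomp Require Import all_classical all_reals all_analysis.

Set Implicit Arguments.
Unset Strict Implicit.
Unset Printing Implicit Defensive.

Import Order.TTheory GRing.Theory Num.Theory.
Import numFieldNormedType.Exports.

Local Open Scope classical_set_scope.
Local Open Scope ring_scope.

(* R^n is 'rV[R]_n. The library norm on 'rV[R]_n is the max norm, so all metric
   notions below use the Euclidean norm defined here; nbhs, closed and
   convergence are those of the library, which both norms induce. *)

Definition dotp (R : realType) (n : nat) (u v : 'rV[R]_n) : R :=
  \sum_(i < n) u ord0 i * v ord0 i.

Definition eucl_norm (R : realType) (n : nat) (u : 'rV[R]_n) : R :=
  Num.sqrt (dotp u u).

Definition eucl_cball (R : realType) (n : nat) (x : 'rV[R]_n) (r : R) :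
    set 'rV[R]_n :=
  [set y | eucl_norm (y - x) <= r].

(* The infimum is a minimum when S is nonempty and closed. *)
Definition dist_set (R : realType) (n : nat) (S : set 'rV[R]_n)
    (x : 'rV[R]_n) : R :=
  inf [set eucl_norm (x - s) | s in S].

Definition projection (R : realType) (n : nat) (S : set 'rV[R]_n)
    (x : 'rV[R]_n) : set 'rV[R]_n :=
  [set s | S s /\ eucl_norm (x - s) = dist_set S x].

Definition projection_inv (R : realType) (n : nat) (S : set 'rV[R]_n)
    (s : 'rV[R]_n) : set 'rV[R]_n :=
  [set x | projection S x s].

Definition alternating_projections (R : realType) (n : nat)
    (A B : set 'rV[R]_n) (a b : nat -> 'rV[R]_n) : Prop :=
  forall k : nat, [/\ A (a k), B (b k), projection B (a k) (b k)
                    & projection A (b k) (a k.+1)].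

Definition enters (R : realType) (n : nat) (V : set 'rV[R]_n)
    (a b : nat -> 'rV[R]_n) : Prop :=
  exists k : nat, V (a k) \/ V (b k).

(* a1 and b1 stand for a^+ and b^+. *)
Definition building_block (R : realType) (n : nat) (A B : set 'rV[R]_n)
    (b a1 b1 : 'rV[R]_n) : Prop :=
  (exists2 a, A a & projection B a b)
  /\ projection A b a1 /\ projection B a1 b1.

(* B intersects A separably at x with exponent omega in [0, 2) and constant
   gamma > 0. *)
Definition intersects_separably (R : realType) (n : nat) (A B : set 'rV[R]_n)
    (x : 'rV[R]_n) (omega gamma : R) : Prop :=
  exists2 U : set 'rV[R]_n, nbhs x U &
    forall b a1 b1 : 'rV[R]_n, building_block A B b a1 b1 ->
      U b -> U a1 -> U b1 ->
      dotp (b - a1) (b1 - a1) <=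
        (1 - gamma * eucl_norm (b1 - a1) `^ omega)
          * eucl_norm (b - a1) * eucl_norm (b1 - a1).

(* B is sigma-Hoelder regular with respect to A at x with constant c > 0, for
   sigma in [0, 1). *)
Definition hoelder_regular (R : realType) (n : nat) (A B : set 'rV[R]_n)
    (x : 'rV[R]_n) (sigma c : R) : Prop :=
  exists2 U : set 'rV[R]_n, nbhs x U &
    forall a1 b1 : 'rV[R]_n, (A `&` U) a1 -> (projection B a1 `&` U) b1 ->
      let r := eucl_norm (a1 - b1) in
      eucl_cball a1 ((1 + c) * r)
        `&` [set b | projection_inv A a1 b
               /\ dotp (a1 - b1) (b - b1)
                    > Num.sqrt c * r `^ (sigma + 1) * eucl_norm (b - b1)]
        `&` B = set0.

(* Main.v *)
Require Import Defs.
From HB Require Import structures.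
From mathcomp Require Import all_boot all_order all_algebra.
From mathcomp Require Import all_classical all_reals all_analysis.
From mathcomp Require Import ring lra zify.

Set Implicit Arguments.
Unset Strict Implicit.
Unset Printing Implicit Defensive.

Import Order.TTheory GRing.Theory Num.Theory.
Import numFieldNormedType.Exports.

Local Open Scope classical_set_scope.
Local Open Scope ring_scope.

(** Write d_k = |b_{k+1} - b_k|, rho_k = |b_k - a_{k+1}| and q = omega / 2.

    The heart of the matter is a three-point inequality for a building block
    b -> a1 -> b1 close to x (block_estimate):
      l |b1 - b|^2 <= |b - a1|^2 - |b1 - a1|^2   and
      kap |b1 - a1|^(1 + q) <= |b1 - b|.
    Separability bounds the angle at a1 from below; by the law of cosines this
    gives the second inequality with kap^2 = 2 gamma.  For the first one, either
    |b - a1| exceeds (1 + c) |b1 - a1|, and then the right-hand side is already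
    a fixed fraction of |b - a1|^2, which controls |b1 - b|^2; or Hoelder
    regularity limits how far the angle at b1 can fall below a right angle, and
    the error it leaves in the law of cosines is at most the fraction
    2 sqrt c / kap of |b1 - b|^2.  That fraction is less than 1 exactly because
    c < gamma / 2.

    Since projecting never increases the gaps, rho inherits both inequalities:
    l d_k^2 <= rho_k^2 - rho_{k+1}^2 and kap rho_{k+1}^(1 + q) <= d_k.
    Two consequences follow by real analysis.
    - d_k <= K (rho_k^(1 - q) - rho_{k+1}^(1 - q)) (step_le_gap), so the length
      of the path b telescopes.  A sequence entering a small enough ball
      therefore never leaves the neighborhood where the block estimate holds
      (trapped_steps), and it converges, with |b_k - bs| <= K rho_k^(1 - q).
    - rho_k^2 - rho_{k+1}^2 >= l kap^2 rho_{k+1}^(2 + omega), which forces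
      rho_k^omega = O(1 / k) (powR_decay).
    Together, |b_k - bs| = O(k^(-(1 - q) / omega)), and
    (1 - q) / omega = (2 - omega) / (2 omega). *)

(** * Euclidean geometry *)

Lemma dotpC (R : realType) (n : nat) (u v : 'rV[R]_n) : dotp u v = dotp v u.
Proof. by apply: eq_bigr => i _; rewrite mulrC. Qed.

Lemma dotpDl (R : realType) (n : nat) (u v w : 'rV[R]_n) :
  dotp (u + v) w = dotp u w + dotp v w.
Proof. by rewrite -big_split; apply: eq_bigr => i _; rewrite mxE mulrDl. Qed.

Lemma dotpZl (R : realType) (n : nat) (k : R) (u w : 'rV[R]_n) :
  dotp (k *: u) w = k * dotp u w.
Proof. by rewrite mulr_sumr; apply: eq_bigr => i _; rewrite mxE mulrA. Qed.

Lemma dotpNl (R : realType) (n : nat) (u w : 'rV[R]_n) :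
  dotp (- u) w = - dotp u w.
Proof. by rewrite -scaleN1r dotpZl mulN1r. Qed.

Lemma dotpDr (R : realType) (n : nat) (u v w : 'rV[R]_n) :
  dotp w (u + v) = dotp w u + dotp w v.
Proof. by rewrite !(dotpC w) dotpDl. Qed.

Lemma dotpZr (R : realType) (n : nat) (k : R) (u w : 'rV[R]_n) :
  dotp w (k *: u) = k * dotp w u.
Proof. by rewrite !(dotpC w) dotpZl. Qed.

Lemma dotpNr (R : realType) (n : nat) (u w : 'rV[R]_n) :
  dotp w (- u) = - dotp w u.
Proof. by rewrite !(dotpC w) dotpNl. Qed.

Lemma dotp_ge0 (R : realType) (n : nat) (u : 'rV[R]_n) : 0 <= dotp u u.
Proof. by apply: sumr_ge0 => i _; rewrite -expr2 sqr_ge0. Qed.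

Lemma eucl_norm_ge0 (R : realType) (n : nat) (u : 'rV[R]_n) : 0 <= eucl_norm u.
Proof. exact: sqrtr_ge0. Qed.

Lemma sqr_eucl_norm (R : realType) (n : nat) (u : 'rV[R]_n) :
  eucl_norm u ^+ 2 = dotp u u.
Proof. by rewrite sqr_sqrtr // dotp_ge0. Qed.

Lemma eucl_normN (R : realType) (n : nat) (u : 'rV[R]_n) :
  eucl_norm (- u) = eucl_norm u.
Proof. by rewrite /eucl_norm dotpNl dotpNr opprK. Qed.

Lemma eucl_distC (R : realType) (n : nat) (u v : 'rV[R]_n) :
  eucl_norm (u - v) = eucl_norm (v - u).
Proof. by rewrite -eucl_normN opprB. Qed.

Lemma entry_le_eucl_norm (R : realType) (n : nat) (u : 'rV[R]_n) (i : 'I_n) :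
  `|u ord0 i| <= eucl_norm u.
Proof.
rewrite -ler_sqr ?nnegrE ?eucl_norm_ge0 // sqr_eucl_norm real_normK ?num_real //.
rewrite /dotp (bigD1 i) //= -expr2 lerDl.
by apply: sumr_ge0 => j _; rewrite -expr2 sqr_ge0.
Qed.

Lemma norm_le_eucl_norm (R : realType) (n : nat) (u : 'rV[R]_n) :
  `|u| <= eucl_norm u.
Proof.
rewrite [leLHS]/Num.norm /= mx_normrE; apply: bigmax_le => [|[i j] _ /=].
  exact: eucl_norm_ge0.
by rewrite ord1 entry_le_eucl_norm.
Qed.

Lemma eucl_norm_le_norm (R : realType) (n : nat) (u : 'rV[R]_n) :
  eucl_norm u <= Num.sqrt n%:R * `|u|.
Proof.
rewrite -[X in _ * X]ger0_norm // -sqrtr_sqr -sqrtrM ?ler0n // ler_sqrt; last first.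
  by rewrite mulr_ge0 ?ler0n ?sqr_ge0.
rewrite /dotp mulr_natl -[n in _ *+ n]card_ord -sumr_const.
apply: ler_sum => i _; rewrite -expr2 -real_normK ?num_real // lerXn2r ?nnegrE //.
rewrite [leRHS]/Num.norm /= mx_normrE.
exact: (le_bigmax _ (fun ij => `|u ij.1 ij.2|) (ord0, i)).
Qed.

Lemma eucl_norm0 (R : realType) (n : nat) : eucl_norm (0 : 'rV[R]_n) = 0.
Proof. by rewrite /eucl_norm -(scale0r 0) dotpZl mul0r sqrtr0. Qed.

Lemma eucl_norm_eq0 (R : realType) (n : nat) (u : 'rV[R]_n) :
  eucl_norm u = 0 -> u = 0.
Proof.
move=> u0; apply/eqP; rewrite -normr_eq0 eq_le normr_ge0 andbT.
by rewrite -u0 norm_le_eucl_norm.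
Qed.

(** Cauchy-Schwarz, from the nonnegativity of the squared norm of
    |v| u - |u| v. *)
Lemma dotp_le_eucl_norm (R : realType) (n : nat) (u v : 'rV[R]_n) :
  dotp u v <= eucl_norm u * eucl_norm v.
Proof.
have [v0|vN0] := eqVneq (eucl_norm v) 0.
  by rewrite (eucl_norm_eq0 v0) -[X in dotp u X](scale0r 0) dotpZr mul0r
             mulr_ge0 ?eucl_norm_ge0.
have [u0|uN0] := eqVneq (eucl_norm u) 0.
  by rewrite (eucl_norm_eq0 u0) -[X in dotp X v](scale0r 0) dotpZl mul0r
             mulr_ge0 ?eucl_norm_ge0.
have hu : 0 < eucl_norm u by rewrite lt_neqAle eq_sym uN0 eucl_norm_ge0.
have hv : 0 < eucl_norm v by rewrite lt_neqAle eq_sym vN0 eucl_norm_ge0.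
have := dotp_ge0 (eucl_norm v *: u - eucl_norm u *: v).
rewrite !(dotpDl, dotpDr, dotpNl, dotpNr, dotpZl, dotpZr) -!sqr_eucl_norm.
rewrite (dotpC v u) => h.
have : 0 <= (eucl_norm u * eucl_norm v) * (eucl_norm u * eucl_norm v - dotp u v).
  by lra.
by rewrite pmulr_rge0 ?mulr_gt0 // subr_ge0.
Qed.

Lemma sqr_eucl_normB (R : realType) (n : nat) (u v : 'rV[R]_n) :
  eucl_norm (u - v) ^+ 2 = eucl_norm u ^+ 2 + eucl_norm v ^+ 2 - 2 * dotp u v.
Proof.
rewrite !sqr_eucl_norm !(dotpDl, dotpDr, dotpNl, dotpNr) (dotpC v u); ring.
Qed.

Lemma ler_eucl_normB (R : realType) (n : nat) (u v : 'rV[R]_n) :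
  eucl_norm (u - v) <= eucl_norm u + eucl_norm v.
Proof.
rewrite -ler_sqr ?nnegrE ?addr_ge0 ?eucl_norm_ge0 // sqr_eucl_normB sqrrD.
have := dotp_le_eucl_norm (- u) v; rewrite eucl_normN dotpNl; lra.
Qed.

Lemma ler_eucl_distD (R : realType) (n : nat) (w u v : 'rV[R]_n) :
  eucl_norm (u - v) <= eucl_norm (u - w) + eucl_norm (w - v).
Proof.
have -> : u - v = (u - w) - (v - w) by rewrite opprB addrA subrK.
by rewrite (eucl_distC w); apply: ler_eucl_normB.
Qed.

(** With the next lemma: the Euclidean and the supremum norm define the same
    neighborhoods. *)
Lemma nbhs_eucl_cball (R : realType) (n : nat) (x : 'rV[R]_n) (r : R) :
  0 < r -> nbhs x (eucl_cball x r).
Proof.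
move=> r0; apply/nbhs_ballP; pose M : R := Num.sqrt n%:R + 1.
have M0 : 0 < M by rewrite ltr_wpDl ?sqrtr_ge0.
exists (r / M) => /=; first exact: divr_gt0.
move=> y; rewrite -ball_normE /= => /ltW xy; rewrite /eucl_cball /= eucl_distC.
apply: le_trans (eucl_norm_le_norm _) _.
have := ler_wpM2l (ltW M0) xy; rewrite mulrCA divff ?gt_eqF // mulr1.
by apply: le_trans; rewrite ler_wpM2r // /M lerDl.
Qed.

Lemma eucl_cball_subset_nbhs (R : realType) (n : nat) (x : 'rV[R]_n)
    (U : set 'rV[R]_n) :
  nbhs x U -> exists2 r : R, 0 < r & eucl_cball x r `<=` U.
Proof.
move=> /nbhs_ballP[r /= r0 rU]; exists (r / 2); first by lra.
move=> y; rewrite /eucl_cball /= => xy; apply: rU; rewrite -ball_normE /=.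
apply: le_lt_trans (norm_le_eucl_norm _) _; rewrite eucl_distC.
by apply: le_lt_trans xy _; lra.
Qed.

Lemma projection_min (R : realType) (n : nat) (S : set 'rV[R]_n)
    (x s t : 'rV[R]_n) :
  projection S x s -> S t -> eucl_norm (x - s) <= eucl_norm (x - t).
Proof.
move=> [_ ->] St; apply: ge_inf; last by exists t.
by exists 0 => _ [z _ <-]; exact: eucl_norm_ge0.
Qed.

(** A modulus of Cauchy convergence is inherited by the limit as a rate. *)
Lemma eucl_cauchy_limit (R : realType) (n : nat) (b : nat -> 'rV[R]_n)
    (e : nat -> R) :
  e @ \oo --> 0 ->
  (forall i j, (i <= j)%N -> eucl_norm (b j - b i) <= e i) ->
  exists2 l : 'rV[R]_n, b @ \oo --> l & forall k, eucl_norm (b k - l) <= e k.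
Proof.
move=> e0 be.
have hb : cvg (b @ \oo).
  apply: cauchy_cvg; apply: cauchy_exP => eps eps0.
  have /cvgrPdist_lt/(_ _ eps0)[N _ hN] := e0.
  exists (b N), N => // k Nk /=; rewrite -ball_normE /= distrC.
  apply: le_lt_trans (norm_le_eucl_norm _) _; apply: le_lt_trans (be _ _ Nk) _.
  have := hN _ (leqnn N); rewrite sub0r normrN; exact/le_lt_trans/ler_norm.
exists (lim (b @ \oo)) => // k; apply/ler_addgt0Pr => eps eps0.
have := hb _ (nbhs_eucl_cball _ eps0) => -[N _ hN].
apply: le_trans (ler_eucl_distD (b (maxn N k)) _ _) _; rewrite lerD //.
  by rewrite eucl_distC be // leq_maxr.
by apply: hN; rewrite /= leq_maxl.
Qed.

Lemma cvg_eucl_dist (R : realType) (n : nat) (b : nat -> 'rV[R]_n) (l : 'rV[R]_n)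
    (e : nat -> R) :
  e @ \oo --> 0 -> (forall k, eucl_norm (b k - l) <= e k) -> b @ \oo --> l.
Proof.
move=> e0 be; apply/cvgrPdist_lt => eps eps0.
have /cvgrPdist_lt/(_ _ eps0)[N _ hN] := e0; exists N => // k Nk /=.
rewrite distrC; apply: le_lt_trans (norm_le_eucl_norm _) _.
apply: le_lt_trans (be _) _.
by have := hN _ Nk; rewrite sub0r normrN; exact/le_lt_trans/ler_norm.
Qed.

(** * Real inequalities and rates of decay *)

Lemma powR_le1 (R : realType) (q x : R) : 0 <= q -> 0 <= x <= 1 -> x `^ q <= 1.
Proof.
move=> q0 /andP[x0 x1]; have <- : (1 : R) `^ q = 1 by rewrite powR1.
by apply: ge0_ler_powR; rewrite ?nnegrE.
Qed.

(** Bernoulli's inequality for exponents below 1: this is Young's inequality for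
    the product of y `^ p and 1, with conjugate exponents 1 / p and 1 / (1 - p). *)
Lemma powR_le_tangent (R : realType) (p y : R) :
  0 < p < 1 -> 0 <= y -> y `^ p <= 1 + p * (y - 1).
Proof.
move=> /andP[p0 p1] y0; have q0 : 0 < 1 - p by lra.
have := @conjugate_powR _ (y `^ p) 1 p^-1 (1 - p)^-1 (powR_ge0 _ _) ler01.
rewrite !invr_gt0 !invrK => /(_ p0 q0); rewrite addrC subrK => /(_ erefl).
rewrite -powRrM divff ?gt_eqF // powRr1 // powR1; lra.
Qed.

(** The tangent inequality at r, rescaled to avoid the negative power r `^ (p - 1)
    of the derivative. *)
Lemma powR_gap (R : realType) (p r s : R) :
  0 < p < 1 -> 0 < r -> 0 <= s -> p * r `^ p * (1 - s / r) <= r `^ p - s `^ p.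
Proof.
move=> hp r0 s0.
have sr : 0 <= s / r by rewrite divr_ge0 // ltW.
have /(ler_wpM2l (powR_ge0 r p)) := powR_le_tangent hp sr.
rewrite -powRM ?(ltW r0) // mulrCA divff ?gt_eqF // mulr1; lra.
Qed.

(** The telescoping bound on the steps, with g the gap r `^ (1-q) - s `^ (1-q).
    By concavity g is at least of the order of (r - s) / r `^ q.  If s is
    comparable to r, the lower bound on d makes r `^ (1 + q) at most of the order
    of d, so that d ^+ 2 <= O(r (r - s)) = O(r `^ (1 + q) g) = O(d g).  If s is
    less than half of r, then g is of the order of r `^ (1 - q), which dominates
    r, and hence d, as r <= 1. *)
Lemma step_le_gap (R : realType) (q l kap : R) :
  0 < q < 1 -> 0 < l -> 0 < kap ->
  exists2 K : R, 0 < K & forall d r s : R,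
    0 <= d -> 0 <= s -> s <= r -> r <= 1 ->
    l * d ^+ 2 <= r ^+ 2 - s ^+ 2 -> kap * s `^ (1 + q) <= d ->
    d <= K * (r `^ (1 - q) - s `^ (1 - q)).
Proof.
move=> /andP[q0 q1] l0 kap0; set p := 1 - q.
have hp : 0 < p < 1 by rewrite /p; lra.
have p0 : 0 < p by case/andP: hp.
pose h : R := 2^-1 `^ (1 + q).
have h0 : 0 < h by apply: powR_gt0; lra.
have sl0 : 0 < Num.sqrt l by rewrite sqrtr_gt0.
(* K1 serves the case r / 2 <= s, K2 the case s < r / 2. *)
pose K1 := 2 / (p * l * kap * h); pose K2 := 2 / (p * Num.sqrt l).
have K10 : 0 < K1 by rewrite divr_gt0 ?mulr_gt0.
have K20 : 0 < K2 by rewrite divr_gt0 ?mulr_gt0.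
exists (K1 + K2); first exact: addr_gt0.
move=> d r s d0 s0 sr r1 ld kd.
have [r0|rN0] := eqVneq r 0.
  have s00 : s = 0 by apply/eqP; rewrite eq_le s0 andbT -r0.
  have : d ^+ 2 <= 0.
    by rewrite -(pmulr_rle0 _ l0); apply: le_trans ld _; rewrite r0 s00; lra.
  rewrite r0 s00 subrr mulr0 => d2; suff : d == 0 by move/eqP->.
  by rewrite -sqrf_eq0 eq_le d2 sqr_ge0.
have r0 : 0 < r by rewrite lt_neqAle eq_sym rN0 (le_trans s0).
set g := r `^ p - s `^ p.
have hg : p * r `^ p * (1 - s / r) <= g := powR_gap hp r0 s0.
have w0 : 0 < r `^ q by exact: powR_gt0.
have rp0 : 0 < r `^ p by exact: powR_gt0.
have rpq : r `^ p * r `^ q = r.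
  rewrite -powRD; last by apply/implyP => _; rewrite gt_eqF.
  by rewrite /p subrK powRr1 // ltW.
have hg2 : p * (r - s) <= g * r `^ q.
  have := ler_wpM2r (ltW w0) hg; apply: le_trans; rewrite le_eqVlt; apply/orP; left.
  apply/eqP; rewrite mulrAC -(mulrA p) rpq -mulrA; congr (_ * _).
  by rewrite mulrBr mulr1 mulrCA divff ?mulr1.
have g0 : 0 <= g.
  by rewrite -(pmulr_lge0 _ w0); apply: le_trans hg2; rewrite mulr_ge0 ?subr_ge0 // ltW.
rewrite mulrDl; have [hs|hs] := leP (r / 2) s.
  apply: (@le_trans _ _ (K1 * g)); last by rewrite lerDl mulr_ge0 // ltW.
  have hrd : kap * (h * (r * r `^ q)) <= d.
    apply: le_trans kd; rewrite ler_pM2l //.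
    have -> : r * r `^ q = r `^ (1 + q).
      by rewrite powRD ?powRr1 ?(ltW r0) //; apply/implyP => _; rewrite gt_eqF.
    rewrite -powRM; [|lra|lra].
    by apply: ge0_ler_powR; rewrite ?nnegrE; lra.
  have dd : 0 < d by apply: lt_le_trans hrd; rewrite !mulr_gt0.
  rewrite /K1 mulrAC ler_pdivlMr ?mulr_gt0 //.
  rewrite -(ler_pM2r dd).
  have h1 : l * d ^+ 2 <= 2 * r * (r - s).
    apply: le_trans ld _; rewrite -subr_ge0.
    have -> : 2 * r * (r - s) - (r ^+ 2 - s ^+ 2) = (r - s) ^+ 2 by ring.
    exact: sqr_ge0.
  have h2 : p * (l * d ^+ 2) <= 2 * r * (g * r `^ q).
    apply: (@le_trans _ _ (p * (2 * r * (r - s)))); first by rewrite ler_pM2l.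
    by rewrite mulrCA ler_pM2l // mulr_gt0.
  have h3 : (kap * h) * (p * (l * d ^+ 2)) <= (kap * h) * (2 * r * (g * r `^ q)).
    by rewrite ler_pM2l // mulr_gt0.
  have h4 : 2 * g * (kap * (h * (r * r `^ q))) <= 2 * g * d.
    by rewrite ler_wpM2l // mulr_ge0.
  have -> : d * (p * l * kap * h) * d = (kap * h) * (p * (l * d ^+ 2)) by ring.
  apply: le_trans h3 _; apply: le_trans h4; rewrite le_eqVlt; apply/orP; left.
  by apply/eqP; ring.
apply: (@le_trans _ _ (K2 * g)); last by rewrite lerDr mulr_ge0 // ltW.
have h1 : Num.sqrt l * d <= r.
  rewrite -ler_sqr ?nnegrE ?mulr_ge0 // ?(ltW r0) ?(ltW sl0) //.
  rewrite exprMn sqr_sqrtr ?(ltW l0) //; apply: le_trans ld _.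
  by rewrite gerBl sqr_ge0.
have h2 : r <= r `^ p by apply: ger1_powR; rewrite ?r0 //; case/andP: hp => _ /ltW.
have h3 : p * r <= 2 * g.
  have w1 : r `^ q <= 1 by apply: powR_le1; lra.
  have : g * r `^ q <= g by apply: ler_piMr.
  have : p * (r / 2) <= p * (r - s) by rewrite ler_pM2l //; lra.
  lra.
rewrite /K2 mulrAC ler_pdivlMr ?mulr_gt0 // mulrC -mulrA.
by apply: le_trans h3; rewrite ler_pM2l.
Qed.

(** A linear lower bound for the concave function (1 + x) `^ q on [0, X],
    obtained from the tangent bound at the inverse of 1 + x. *)
Lemma powR_1Dx_ge (R : realType) (q X x : R) :
  0 < q < 1 -> 0 <= x <= X -> 1 + q / (1 + X) * x <= (1 + x) `^ q.
Proof.
move=> hq /andP[x0 xX]; have /andP[q0 q1] := hq.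
have y0 : 0 <= (1 + x)^-1 by rewrite invr_ge0; lra.
have := powR_le_tangent hq y0.
set z := (1 + x) `^ q; have z0 : 0 < z by apply: powR_gt0; lra.
have -> : (1 + x)^-1 `^ q = z^-1.
  by rewrite /z -!powR_inv1 ?powR_ge0 // -?powRrM ?mulN1r ?mulrN1 //; lra.
have -> : (1 + x)^-1 - 1 = - (x / (1 + x)) by field; lra.
set s := x / (1 + x) => hz.
have s0 : 0 <= s by rewrite divr_ge0 //; lra.
have s1 : s < 1 by rewrite /s ltr_pdivrMr; lra.
have qs1 : q * s < 1 by apply: le_lt_trans s1; rewrite ler_piMl // ltW.
have h1 : 1 <= z * (1 - q * s).
  by have := ler_wpM2l (ltW z0) hz; rewrite divff ?gt_eqF //; lra.
apply: (@le_trans _ _ (1 + q * s)).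
  rewrite lerD2l -mulrA ler_pM2l // mulrC /s ler_wpM2l // lef_pV2 ?posrE; lra.
rewrite -(@ler_pM2r _ (1 - q * s)); last lra.
apply: le_trans h1; have := sqr_ge0 (q * s); lra.
Qed.

(** The discrete form of t' <= - kap t ^ 2.  The bound is an induction: if t k.+1
    exceeded M / (k + 2), then t k would exceed
    M / (k + 2) * (1 + kap M / (k + 2)), which is at least M / (k + 1) once
    kap M >= 2 + kap. *)
Lemma harmonic_decay (R : realType) (kap : R) (t : nat -> R) :
  0 < kap -> t 0%N <= 1 ->
  (forall k, t k.+1 * (1 + kap * t k.+1) <= t k) ->
  forall k, t k <= (1 + (2 + kap) / kap) * k.+1%:R^-1.
Proof.
move=> kap0 t1 ht; set M := 1 + _; have M0 : 0 < M.
  by rewrite addr_gt0 // divr_gt0 //; lra.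
have MK : 2 + kap <= kap * M.
  rewrite /M mulrDr mulr1 mulrCA divff ?gt_eqF //; lra.
elim=> [|k IH].
  by rewrite invr1 mulr1 (le_trans t1) // /M lerDl divr_ge0 //; lra.
rewrite leNgt; apply/negP => hk; have := ht k; apply/negP; rewrite -ltNge.
apply: le_lt_trans IH _; set m : R := M * k.+2%:R^-1 in hk.
have m0 : 0 < m by rewrite divr_gt0.
apply: (@le_lt_trans _ _ (m * (1 + kap * m))); last first.
  apply: ltr_pM => //; first exact: ltW.
    by rewrite addr_ge0 // mulr_ge0 // ltW.
  by rewrite ltrD2l ltr_pM2l.
rewrite /m -mulrA ler_pM2l //; rewrite -[k.+2]addn1 natrD.
set x : R := k.+1%:R; have x1 : 1 <= x by rewrite /x ler1n.
have x0 : 0 < x by lra.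
have y0 : 0 < x + 1 by lra.
have -> : (x + 1)^-1 * (1 + kap * (M / (x + 1))) = (x + 1 + kap * M) / (x + 1) ^+ 2.
  by field; lra.
rewrite ler_pdivlMr ?exprn_gt0 // mulrC ler_pdivrMr //.
have : (2 + kap) * x <= kap * M * x by rewrite ler_wpM2r // ltW.
have : 0 <= kap * x by rewrite mulr_ge0 // ltW.
lra.
Qed.

(** The hypothesis reads rho_k ^ 2 >= rho_{k+1} ^ 2 (1 + C rho_{k+1} ^ om); raised
    to the power om / 2 < 1 and linearized, it becomes the recursion of
    harmonic_decay for rho ^ om.  The constant does not depend on rho. *)
Lemma powR_decay (R : realType) (om C : R) :
  0 < om < 2 -> 0 < C ->
  exists2 M : R, 0 < M & forall rho : nat -> R,
    (forall k, 0 <= rho k) -> rho 0%N <= 1 ->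
    (forall k, rho k.+1 <= rho k) ->
    (forall k, C * (rho k.+1 `^ om * rho k.+1 ^+ 2)
                 <= rho k ^+ 2 - rho k.+1 ^+ 2) ->
    forall k, rho k `^ om <= M * k.+1%:R^-1.
Proof.
move=> /andP[om0 om2] C0; set q := om / 2.
have hq : 0 < q < 1 by rewrite /q; lra.
have q0 : 0 < q by case/andP: hq.
pose kap := q / (1 + C) * C.
have kap0 : 0 < kap by rewrite mulr_gt0 // divr_gt0 //; lra.
exists (1 + (2 + kap) / kap); first by rewrite addr_gt0 // divr_gt0 //; lra.
move=> rho rho0 rho1 rhoS hrho.
have le1 k : rho k <= 1 by elim: k => // k IH; exact: le_trans (rhoS k) IH.
apply: harmonic_decay => // [|k].
  by apply: powR_le1; rewrite ?rho0 ?le1 // ltW.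
have sq k' : rho k' `^ om = (rho k' ^+ 2) `^ q.
  by rewrite -powR_mulrn // -powRrM /q mulrCA divff // mulr1.
set t := rho k.+1 `^ om.
have t0 : 0 <= t by exact: powR_ge0.
have tle1 : t <= 1.
  by apply: powR_le1; rewrite ?rho0 ?le1 // ltW.
have -> : rho k `^ om = (rho k ^+ 2) `^ q by exact: sq.
apply: (@le_trans _ _ ((rho k.+1 ^+ 2 * (1 + C * t)) `^ q)); last first.
  apply: ge0_ler_powR; rewrite ?nnegrE ?(ltW q0) ?sqr_ge0 //.
    by rewrite mulr_ge0 ?sqr_ge0 // addr_ge0 // mulr_ge0 // ltW.
  have := hrho k; rewrite -/t; lra.
rewrite powRM ?sqr_ge0 //; last by rewrite addr_ge0 // mulr_ge0 // ltW.
rewrite -sq -/t ler_wpM2l //.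
apply: le_trans (powR_1Dx_ge hq (_ : 0 <= C * t <= C)); last first.
  by rewrite mulr_ge0 ?(ltW C0) //= ler_piMr ?(ltW C0).
by rewrite /kap mulrA.
Qed.

(** Estimates are obtained from the index m at which the sequence enters the
    neighborhood; the shift costs only a constant, because k - m + 1 >= k / 2 for
    k > 2 m. *)
Lemma bigO_shift (R : realType) (e C : R) (m : nat) (u : nat -> R) :
  0 < e -> 0 < C -> (forall k, 0 <= u k) ->
  (forall k, u (k + m)%N <= C * k.+1%:R^-1 `^ e) ->
  u =O_\oo (fun k : nat => k%:R `^ (- e)).
Proof.
move=> e0 C0 u0 hu; apply/eqO_exP.
exists (C * 2 `^ e); first by rewrite mulr_gt0 // powR_gt0.
exists (m.*2.+1) => // k /= hk.
have mk : (m <= k)%N by apply: leq_trans (ltnW hk); rewrite -addnn leq_addr.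
rewrite ger0_norm // ger0_norm ?powR_ge0 // -mulrA.
rewrite -{1}(subnK mk); apply: le_trans (hu _) _; rewrite ler_pM2l //.
have -> : k%:R `^ (- e) = (k%:R^-1 : R) `^ e.
  by rewrite -mulN1r powRrM powR_inv1 // ler0n.
have k0 : (0 < k)%N by apply: leq_trans hk.
rewrite -powRM ?invr_ge0 ?ler0n //; apply: ge0_ler_powR.
- exact: ltW.
- by rewrite nnegrE invr_ge0 ler0n.
- by rewrite nnegrE mulr_ge0 ?invr_ge0 ?ler0n.
rewrite -[2]invrK -invfM lef_pV2 ?posrE ?mulr_gt0 ?invr_gt0 ?ltr0n //.
rewrite mulrC ler_pdivrMr // -natrM ler_nat muln2.
by rewrite -addnn; move: hk mk; rewrite -addnn; lia.
Qed.

(** * The three-point inequality for building blocks *)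

(** The triangle b, a1, b1 enters only through its side lengths
    rho = |b - a1|, r = |b1 - a1|, d = |b1 - b|, the inner products s at a1 and
    D at b1, and w, which stands for r `^ (omega / 2). *)
Lemma three_point_inequality (R : realType) (c gamma : R) :
  0 < c -> c < gamma / 2 ->
  exists2 l : R, 0 < l & forall rho r d w s D : R,
    0 <= r <= rho -> 0 <= d <= rho + r -> 0 <= w ->
    d ^+ 2 = rho ^+ 2 + r ^+ 2 - 2 * s ->
    s <= (1 - gamma * w ^+ 2) * rho * r ->
    rho ^+ 2 = r ^+ 2 + d ^+ 2 - 2 * D ->
    (rho <= (1 + c) * r -> D <= Num.sqrt c * (w * r) * d) ->
    Num.sqrt (2 * gamma) * (w * r) <= d /\ l * d ^+ 2 <= rho ^+ 2 - r ^+ 2.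
Proof.
move=> c0 hc; have g0 : 0 < gamma by lra.
set kap := Num.sqrt (2 * gamma).
have kap0 : 0 < kap by rewrite sqrtr_gt0 mulr_gt0.
have kap2 : kap ^+ 2 = 2 * gamma by rewrite sqr_sqrtr // mulr_ge0 // ltW.
have sc0 : 0 < Num.sqrt c by rewrite sqrtr_gt0.
have sck : 2 * Num.sqrt c < kap.
  rewrite -ltr_sqr ?nnegrE ?(ltW kap0) ?mulr_ge0 ?(ltW sc0) //.
  by rewrite exprMn kap2 sqr_sqrtr ?(ltW c0) //; lra.
pose l1 := 1 - 2 * Num.sqrt c / kap; pose l2 := c / (2 * (1 + c)).
have l10 : 0 < l1 by rewrite subr_gt0 ltr_pdivrMr // mul1r.
have l20 : 0 < l2 by rewrite divr_gt0 //; lra.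
exists (Num.min l1 l2); first by rewrite lt_min l10.
move=> rho r d w s D /andP[r0 rr] /andP[d0 drr] w0 hd hs hrho hD.
have rho0 : 0 <= rho by exact: le_trans rr.
have kd : kap * (w * r) <= d.
  rewrite -ler_sqr ?nnegrE ?mulr_ge0 // ?(ltW kap0) //.
  rewrite exprMn kap2 hd.
  have : 0 <= 2 * gamma * w ^+ 2 * r * (rho - r).
    by rewrite !mulr_ge0 ?sqr_ge0 ?subr_ge0 // ltW.
  have := sqr_ge0 (rho - r).
  lra.
split => //; have [hr|hr] := leP rho ((1 + c) * r).
  apply: (@le_trans _ _ (l1 * d ^+ 2)).
    by rewrite ler_wpM2r ?sqr_ge0 // ge_min lexx.
  have {}hD := hD hr.
  (* Trading one factor w * r for d / kap turns the error into a multiple of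
     d ^+ 2. *)
  have h1 : 2 * (Num.sqrt c * (w * r) * d) <= 2 * Num.sqrt c / kap * d ^+ 2.
    have -> : 2 * (Num.sqrt c * (w * r) * d)
        = (2 * Num.sqrt c / kap * d) * (kap * (w * r)) by field; lra.
    rewrite expr2 (mulrA _ d d) ler_wpM2l // mulr_ge0 // divr_ge0 ?(ltW kap0) //.
  rewrite /l1; lra.
apply: (@le_trans _ _ (l2 * d ^+ 2)).
  by rewrite ler_wpM2r ?sqr_ge0 // ge_min lexx orbT.
(* Here rho - r is a fixed fraction of rho, hence of rho + r >= d. *)
have h1 : d ^+ 2 <= (rho + r) ^+ 2 by rewrite lerXn2r // nnegrE addr_ge0.
have h2 : c / (1 + c) * rho <= rho - r.
  rewrite mulrAC ler_pdivrMr; lra.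
have h3 : (rho + r) / 2 <= rho by lra.
apply: (@le_trans _ _ (l2 * (rho + r) ^+ 2)); first by rewrite ler_wpM2l // ltW.
have -> : l2 * (rho + r) ^+ 2 = (c / (1 + c) * ((rho + r) / 2)) * (rho + r).
  by rewrite /l2; field; lra.
have -> : rho ^+ 2 - r ^+ 2 = (rho - r) * (rho + r) by ring.
rewrite ler_wpM2r ?addr_ge0 //; apply: le_trans h2; rewrite ler_wpM2l //.
rewrite divr_ge0; lra.
Qed.

(** Only the starting point b has to be near x: the rest of the block is then
    near x as well, because x lies in both sets. *)
Lemma block_estimate (R : realType) (n : nat) (A B : set 'rV[R]_n)
    (x : 'rV[R]_n) (omega gamma c : R) :
  A x -> B x -> 0 < omega -> 0 < c -> c < gamma / 2 ->
  intersects_separably A B x omega gamma ->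
  hoelder_regular A B x (omega / 2) c ->
  exists l kap eps : R, [/\ 0 < l, 0 < kap, 0 < eps &
    forall b a1 b1, building_block A B b a1 b1 -> eucl_norm (b - x) <= eps ->
      kap * eucl_norm (b1 - a1) `^ (1 + omega / 2) <= eucl_norm (b1 - b)
      /\ l * eucl_norm (b1 - b) ^+ 2
           <= eucl_norm (b - a1) ^+ 2 - eucl_norm (b1 - a1) ^+ 2].
Proof.
move=> Ax Bx om0 c0 hc [U1 nU1 hU1] [U2 nU2 hU2].
have [l l0 hl] := three_point_inequality c0 hc.
have [e e0 he] := eucl_cball_subset_nbhs (filterI nU1 nU2).
(* Each projection moves a point by at most its distance to x, so a block that
   starts within e / 3 of x stays within e of x. *)
exists l, (Num.sqrt (2 * gamma)), (e / 3); split => //; [|lra|].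
  by rewrite sqrtr_gt0; lra.
move=> b a1 b1 hb bx; have [[a Aa [Bb _]] [pa1 pb1]] := hb.
have Ba1 : B b1 by case: pb1.
have Aa1 : A a1 by case: pa1.
have ba1 : eucl_norm (b - a1) <= eucl_norm (b - x) := projection_min pa1 Ax.
have b1a1 : eucl_norm (b1 - a1) <= eucl_norm (b - a1).
  by rewrite eucl_distC (eucl_distC b) (projection_min pb1 Bb).
have a1x : eucl_norm (a1 - x) <= 2 * (e / 3).
  have := ler_eucl_distD b a1 x; rewrite (eucl_distC a1 b); lra.
have b1x : eucl_norm (b1 - x) <= e.
  have := ler_eucl_distD a1 b1 x; lra.
have [U1b U2b] : (U1 `&` U2) b by apply: he; rewrite /eucl_cball /=; lra.
have [U1a U2a] : (U1 `&` U2) a1 by apply: he; rewrite /eucl_cball /=; lra.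
have [U1b1 U2b1] : (U1 `&` U2) b1 by exact: he.
set r := eucl_norm (b1 - a1); have r0 : 0 <= r by exact: eucl_norm_ge0.
have q0 : 0 < omega / 2 by lra.
have rw : r `^ (1 + omega / 2) = r `^ (omega / 2) * r.
  rewrite [RHS]mulrC powRD ?powRr1 //; apply/implyP => /eqP; lra.
rewrite rw.
apply: (hl _ _ _ _ (dotp (b - a1) (b1 - a1)) (dotp (a1 - b1) (b - b1))).
- by rewrite r0.
- rewrite eucl_norm_ge0 /= (eucl_distC b a1) (addrC _ r).
  exact: ler_eucl_distD.
- exact: powR_ge0.
- have -> : b1 - b = (b1 - a1) - (b - a1) by rewrite opprB addrA subrK.
  by rewrite sqr_eucl_normB (dotpC (b1 - a1)) (addrC (r ^+ 2)).
- have -> : (r `^ (omega / 2)) ^+ 2 = r `^ omega.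
    by rewrite -powR_mulrn ?powR_ge0 // -powRrM divfK.
  exact: hU1.
- have -> : b - a1 = (b - b1) - (a1 - b1) by rewrite opprB addrA subrK.
  rewrite sqr_eucl_normB (dotpC (b - b1)) (eucl_distC b b1) (eucl_distC a1 b1).
  by rewrite (addrC (r ^+ 2)).
- move=> hr; rewrite leNgt; apply/negP => hD.
  have := hU2 _ _ (conj Aa1 U2a) (conj pb1 U2b1).
  rewrite /= => /seteqP[/(_ b) h _]; apply: h; split => //; split.
    by rewrite /eucl_cball /= (eucl_distC a1).
  split => //=.
  by rewrite (eucl_distC a1) (addrC _ 1) rw (eucl_distC b b1).
Qed.

(** * Trapping and convergence *)

Lemma eucl_path_le (R : realType) (n : nat) (b : nat -> 'rV[R]_n)
    (K : R) (phi : nat -> R) :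
  (forall k, eucl_norm (b k.+1 - b k) <= K * (phi k - phi k.+1)) ->
  forall i j, (i <= j)%N -> eucl_norm (b j - b i) <= K * (phi i - phi j).
Proof.
move=> hb i j /subnKC <-; elim: (j - i)%N => [|m IH].
  by rewrite addn0 !subrr mulr0 eucl_norm0.
apply: le_trans (ler_eucl_distD (b (i + m)%N) _ _) _.
rewrite addnS; have := hb (i + m)%N; lra.
Qed.

(** The length bound for the steps is known only inside the ball, but it keeps
    the sequence inside: |b k - x| + K phi k never increases. *)
Lemma trapped_steps (R : realType) (n : nat) (b : nat -> 'rV[R]_n)
    (x : 'rV[R]_n) (eps K : R) (phi : nat -> R) :
  0 <= K -> (forall k, 0 <= phi k) ->
  eucl_norm (b 0%N - x) + K * phi 0%N <= eps ->
  (forall k, eucl_norm (b k - x) <= eps ->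
     eucl_norm (b k.+1 - b k) <= K * (phi k - phi k.+1)) ->
  forall k, eucl_norm (b k - x) <= eps.
Proof.
move=> K0 phi0 h0 hstep k.
have hK j : 0 <= K * phi j by exact: mulr_ge0.
suff : eucl_norm (b k - x) + K * phi k <= eps by have := hK k; lra.
elim: k => // k IH.
have hk : eucl_norm (b k - x) <= eps by have := hK k; lra.
have := hstep k hk; have := ler_eucl_distD (b k) (b k.+1) x; lra.
Qed.

Lemma decay_cvg0 (R : realType) (e C : R) :
  0 < e -> (fun k : nat => C * (k.+1%:R^-1 : R) `^ e) @ \oo --> (0 : R).
Proof.
move=> e0; rewrite -(mulr0 C); apply: cvgMr; apply/cvgrPdist_lt => eps eps0.
have d0 : 0 < eps `^ e^-1 by exact: powR_gt0.
have /cvgrPdist_lt/(_ _ d0)[N _ hN] := @cvg_harmonic R.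
exists N => // k Nk; have := hN k Nk; rewrite /= !sub0r !normrN /harmonic /=.
rewrite !ger0_norm ?powR_ge0 ?invr_ge0 ?ler0n // => h.
have -> : eps = (eps `^ e^-1) `^ e.
  by rewrite -powRrM mulVf ?gt_eqF // powRr1 // ltW.
by apply: gt0_ltr_powR; rewrite ?nnegrE ?invr_ge0 ?ler0n ?powR_ge0.
Qed.

Lemma exists_trap_radius (R : realType) (p K eps : R) :
  0 < p -> 0 < K -> 0 < eps ->
  exists d : R, [/\ 0 < d, d <= 1 & d + K * d `^ p <= eps].
Proof.
move=> p0 K0 eps0; pose z := (eps / (2 * K)) `^ p^-1.
have e0 : 0 < eps / (2 * K) by rewrite divr_gt0 ?mulr_gt0.
exists (Num.min 1 (Num.min (eps / 2) z)).
split; first by rewrite !lt_min ltr01 divr_gt0 // powR_gt0.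
  by rewrite ge_min lexx.
set d := Num.min _ _.
have d0 : 0 < d by rewrite !lt_min ltr01 divr_gt0 // powR_gt0.
have d1 : d <= eps / 2 by rewrite !ge_min lexx orbT.
have d2 : d <= z by rewrite !ge_min lexx !orbT.
suff : K * d `^ p <= eps / 2 by lra.
have : d `^ p <= z `^ p.
  by apply: ge0_ler_powR; rewrite ?nnegrE ?powR_ge0 // ltW.
rewrite -powRrM mulVf ?gt_eqF // powRr1 ?(ltW e0) // => h.
apply: (@le_trans _ _ (K * (eps / (2 * K)))); first by rewrite ler_pM2l.
rewrite le_eqVlt; apply/orP; left; apply/eqP; field; lra.
Qed.

Theorem corollary4 (R : realType) (n : nat) (A B : set 'rV[R]_n)
    (x : 'rV[R]_n) (omega gamma c : R)
    (hA0 : A !=set0) (hB0 : B !=set0) (hA : closed A) (hB : closed B)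
    (hx : (A `&` B) x)
    (homega0 : 0 < omega) (homega2 : omega < 2) (hgamma : 0 < gamma)
    (hsep : intersects_separably A B x omega gamma)
    (hc0 : 0 < c) (hc : c < gamma / 2)
    (hreg : hoelder_regular A B x (omega / 2) c) :
  exists2 V : set 'rV[R]_n, nbhs x V &
    forall a b : nat -> 'rV[R]_n,
      alternating_projections A B a b -> enters V a b ->
      exists2 bs : 'rV[R]_n, (A `&` B) bs &
        [/\ a @ \oo --> bs, b @ \oo --> bs,
            (fun k : nat => eucl_norm (b k - bs)) =O_\oo
              (fun k : nat => k%:R `^ (- ((2 - omega) / (2 * omega))))
          & (fun k : nat => eucl_norm (a k - bs)) =O_\oo
              (fun k : nat => k%:R `^ (- ((2 - omega) / (2 * omega))))].
Proof.
have [Ax Bx] := hx.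
have [l [kap [eps [l0 kap0 eps0 hblock]]]] :=
  block_estimate Ax Bx homega0 hc0 hc hsep hreg.
have hq : 0 < omega / 2 < 1 by apply/andP; split; lra.
set p := 1 - omega / 2.
have p0 : 0 < p by rewrite /p; lra.
have p1 : p <= 1 by rewrite /p; lra.
have [K K0 hK] := step_le_gap hq l0 kap0.
have C0 : 0 < l * kap ^+ 2 by rewrite mulr_gt0 // exprn_gt0.
have homega : 0 < omega < 2 by rewrite homega0.
have [M M0 hM] := powR_decay homega C0.
set e := (2 - omega) / (2 * omega).
have pe : p = omega * e by rewrite /p /e; field; lra.
have e0 : 0 < e by rewrite divr_gt0 //; lra.
have [d [d0 d1 hd]] := exists_trap_radius p0 K0 eps0.
exists (eucl_cball x (d / 2)); first by apply: nbhs_eucl_cball; lra.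
move=> a b hab [m hm].
have bmx : eucl_norm (b m - x) <= d.
  have [_ _ pB _] := hab m; case: hm; rewrite /eucl_cball /= => hm; last by lra.
  have := projection_min pB Bx.
  have := ler_eucl_distD (a m) (b m) x; rewrite (eucl_distC (b m) (a m)); lra.
(* From here on the sequence is restarted at the index m of entrance. *)
pose b' k := b (k + m)%N; pose a' k := a (k + m).+1.
pose rho k := eucl_norm (b' k - a' k).
have block k : building_block A B (b' k) (a' k) (b' k.+1).
  have [Aa Bb pB pA] := hab (k + m)%N; have [_ _ pB' _] := hab (k + m).+1.
  by split; first exists (a (k + m)%N).
have rho0 k : 0 <= rho k by exact: eucl_norm_ge0.
have phi0 k : 0 <= rho k `^ p by exact: powR_ge0.
have rhoS1 k : rho k.+1 <= eucl_norm (b' k.+1 - a' k).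
  have [_ _ _ pA] := hab (k.+1 + m)%N; apply: (projection_min pA).
  by have [] := hab (k + m).+1.
have rhoS2 k : eucl_norm (b' k.+1 - a' k) <= rho k.
  have [_ _ pB _] := hab (k + m).+1; rewrite eucl_distC /rho (eucl_distC (b' k)).
  by apply: (projection_min pB); have [] := hab (k + m)%N.
have rhoS k : rho k.+1 <= rho k by exact: le_trans (rhoS2 k).
have rho0d : rho 0%N <= d.
  by have [_ _ _ pA] := hab m; apply: le_trans (projection_min pA Ax) bmx.
(* The choice of d bounds rho by 1, as step_le_gap and powR_decay require. *)
have rho1 k : rho k <= 1.
  by elim: k => [|k IH]; [exact: le_trans d1 | exact: le_trans (rhoS k) IH].
have q0 : 0 <= 1 + omega / 2 by lra.
have hest k : eucl_norm (b' k - x) <= eps ->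
    kap * rho k.+1 `^ (1 + omega / 2) <= eucl_norm (b' k.+1 - b' k)
    /\ l * eucl_norm (b' k.+1 - b' k) ^+ 2 <= rho k ^+ 2 - rho k.+1 ^+ 2.
  move=> hk; have [h1 h2] := hblock _ _ _ (block k) hk; split.
    apply: le_trans h1; rewrite ler_pM2l //.
    by apply: ge0_ler_powR; rewrite ?nnegrE ?eucl_norm_ge0.
  apply: le_trans h2 _; rewrite lerD2l lerN2 lerXn2r ?nnegrE ?eucl_norm_ge0 //.
have hstep k : eucl_norm (b' k - x) <= eps ->
    eucl_norm (b' k.+1 - b' k) <= K * (rho k `^ p - rho k.+1 `^ p).
  move=> hk; have [h1 h2] := hest k hk.
  by apply: hK => //; exact: eucl_norm_ge0.
have trap : forall k, eucl_norm (b' k - x) <= eps.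
  apply: (trapped_steps (ltW K0) phi0 _ hstep).
  apply: le_trans hd; rewrite lerD // ler_pM2l //.
  by apply: ge0_ler_powR; rewrite ?nnegrE // ltW.
have hrate k : rho k `^ omega <= M * k.+1%:R^-1.
  apply: hM => // j; have [h1 h2] := hest j (trap j).
  apply: le_trans h2; rewrite -mulrA ler_pM2l //.
  have -> : rho j.+1 `^ omega * rho j.+1 ^+ 2 = (rho j.+1 `^ (1 + omega / 2)) ^+ 2.
    rewrite -!powR_mulrn ?powR_ge0 // -powRrM -powRD; last first.
      by apply/implyP => /eqP; lra.
    by congr (_ `^ _); lra.
  rewrite -exprMn lerXn2r // nnegrE ?eucl_norm_ge0 //.
  by rewrite mulr_ge0 ?powR_ge0 // ltW.
have hphi k : rho k `^ p <= M `^ e * k.+1%:R^-1 `^ e.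
  rewrite pe powRrM -powRM ?invr_ge0 ?ler0n // ?(ltW M0) //.
  apply: ge0_ler_powR; rewrite ?nnegrE ?powR_ge0 // ?(ltW e0) //.
  by rewrite mulr_ge0 ?invr_ge0 ?ler0n // ltW.
have hpath i j : (i <= j)%N ->
    eucl_norm (b' j - b' i) <= (K * M `^ e) * i.+1%:R^-1 `^ e.
  move=> ij; have hs k : _ := hstep k (trap k).
  apply: le_trans (eucl_path_le hs ij) _; rewrite -mulrA ler_pM2l //.
  by apply: le_trans (hphi i); rewrite gerBl.
have [bs bbs hbs] := eucl_cauchy_limit (decay_cvg0 _ e0) hpath.
(* As rho k <= 1 and p <= 1, the extra distance rho k between a' k and b' k is
   at most rho k `^ p, so it does not worsen the rate. *)
have habs k : eucl_norm (a' k - bs) <= ((1 + K) * M `^ e) * k.+1%:R^-1 `^ e.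
  have := ler_eucl_distD (b' k) (a' k) bs; rewrite (eucl_distC (a' k) (b' k)) -/(rho k).
  have rk : rho k <= rho k `^ p.
    have [->|rN0] := eqVneq (rho k) 0; first exact: powR_ge0.
    by apply: ger1_powR => //; rewrite rho1 lt_neqAle eq_sym rN0 rho0.
  have := hbs k; have := hphi k; lra.
have abs := cvg_eucl_dist (decay_cvg0 _ e0) habs.
have a_bs : a @ \oo --> bs.
  have aE : a' = (fun k => a (k + m.+1)%N).
    by apply/funext => k; rewrite /a' addnS.
  by rewrite -(cvg_shiftn m.+1); rewrite aE in abs; exact: abs.
have b_bs : b @ \oo --> bs by rewrite -(cvg_shiftn m).
exists bs.
  split; [apply: (closed_cvg _ hA _ _ a_bs) | apply: (closed_cvg _ hB _ _ b_bs)];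
    by apply: nearW => k; have [] := hab k.
split => //.
  apply: (@bigO_shift _ _ (K * M `^ e) m) => // [|k]; last exact: eucl_norm_ge0.
  by rewrite mulr_gt0 // powR_gt0.
apply: (@bigO_shift _ _ ((1 + K) * M `^ e) m.+1) => // [|k|k].
- by rewrite mulr_gt0 ?powR_gt0 //; lra.
- exact: eucl_norm_ge0.
- by rewrite addnS; exact: habs.
Qed.
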